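(* For all integers $k,\ell\ge 3$: (i) $\gamma_{gr}^{t}(P_k\boxtimes P_\ell)\le k\ell-\min\{k,\ell\}$; (ii) $\gamma_{gr}^{t}(C_k\boxtimes C_\ell)\le k\ell-\min\{2k,2\ell\}$; (iii) $\gamma_{gr}^{t}(P_k\boxtimes C_\ell)\le k\ell-\min\{2k,\ell\}$.
   Context: $P_n$ and $C_n$ denote the path and the cycle on $n$ vertices. $N(v)$ denotes the open neighborhood of $v$. A sequence $(v_1,\ldots,v_m)$ of distinct vertices of a graph $G$ is a (legal) open neighborhood sequence if $N(v_i)\setminus\bigcup_{j=1}^{i-1}N(v_j)\neq\emptyset$ for each $i$. The Grundy total domination number $\gamma_{gr}^{t}(G)$ is the maximum length of a legal open neighborhood sequence of $G$. The strong product $G\boxtimes H$ has vertex set $V(G)\times V(H)$, and $(g_1,h_1)$, $(g_2,h_2)$ are adjacent iff $g_1g_2\in E(G)$ and $h_1=h_2$, or $g_1=g_2$ and $h_1h_2\in E(H)$, or $g_1g_2\in E(G)$ and $h_1h_2\in E(H)$. *)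

(* Defs.v *)
From mathcomp Require Import all_boot.

Set Implicit Arguments.
Unset Strict Implicit.
Unset Printing Implicit Defensive.

(* A finite simple graph is given by its adjacency relation, symmetric and
   irreflexive, on a finite type of vertices. *)

Definition path_graph (n : nat) : rel 'I_n :=
  fun i j => (i.+1 == j :> nat) || (j.+1 == i :> nat).

(* [ordS] is the cyclic successor i |-> i + 1 mod n; the relation is a simple
   graph, the n-cycle, only for n >= 3. *)
Definition cycle_graph (n : nat) : rel 'I_n :=
  fun i j => (ordS i == j) || (ordS j == i).

Definition strong_product (T U : finType) (e : rel T) (f : rel U) :
    rel (T * U)%type :=
  fun x y => [|| e x.1 y.1 && (x.2 == y.2),
                 (x.1 == y.1) && f x.2 y.2
               | e x.1 y.1 && f x.2 y.2].

Section GrundyTotalDomination.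

Variables (T : finType) (e : rel T).

Definition open_nbh (v : T) : {set T} := [set w | e v w].

Definition legal_open_nbh_seq (m : nat) (s : m.-tuple T) : bool :=
  uniq s &&
  [forall i : 'I_m,
     open_nbh (tnth s i) :\:
       \bigcup_(j < m | (j < i)%N) open_nbh (tnth s j) != set0].

(* The vertices of a legal sequence are distinct, so its length is at most
   #|T| and the maximum may be taken over m <= #|T|. *)
Definition grundy_total_dom : nat :=
  \max_(m < #|T|.+1 | [exists s : m.-tuple T, legal_open_nbh_seq s]) m.

Lemma leq_grundy_total_dom (m : nat) (s : m.-tuple T) :
  legal_open_nbh_seq s -> m <= grundy_total_dom.
Proof.
move=> ls; have /andP[us _] := ls.
have lt_m : m < #|T|.+1 by rewrite ltnS -(size_tuple s) -(card_uniqP us) max_card.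
by apply: (bigmax_sup (Ordinal lt_m)) => //; apply/existsP; exists s.
Qed.

Lemma grundy_total_dom_attained :
  exists s : grundy_total_dom.-tuple T, legal_open_nbh_seq s.
Proof.
pose P m := exists s : m.-tuple T, legal_open_nbh_seq s.
rewrite -/(P _) /grundy_total_dom; apply: (big_ind P) => [|m n Pm Pn|m /existsP //].
- exists [tuple]; rewrite /legal_open_nbh_seq /=.
  by apply/forallP => -[].
- by rewrite /maxn; case: ifP.
Qed.

End GrundyTotalDomination.

Lemma path_graph_sym n : symmetric (@path_graph n).
Proof. by move=> i j; rewrite /path_graph orbC. Qed.

Lemma path_graph_irr n : irreflexive (@path_graph n).
Proof. by move=> i; rewrite /path_graph orbb; apply/eqP => /esym/n_Sn. Qed.

Lemma cycle_graph_sym n : symmetric (@cycle_graph n).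
Proof. by move=> i j; rewrite /cycle_graph orbC. Qed.

Lemma cycle_graph_irr n : 2 < n -> irreflexive (@cycle_graph n).
Proof.
move=> n3 i; rewrite /cycle_graph orbb -val_eqE /=.
apply/eqP; have := ltn_ord i; case: i => i /= _.
rewrite leq_eqVlt => /orP[/eqP Ei|lt_i E].
  by rewrite Ei modnn => i0; move: n3; rewrite -Ei -i0.
by move: E; rewrite modn_small // => /esym/n_Sn.
Qed.

Lemma strong_product_sym (T U : finType) (e : rel T) (f : rel U) :
  symmetric e -> symmetric f -> symmetric (strong_product e f).
Proof.
move=> se sf x y; rewrite /strong_product se sf.
by rewrite (eq_sym x.1) (eq_sym x.2).
Qed.

Lemma strong_product_irr (T U : finType) (e : rel T) (f : rel U) :
  irreflexive e -> irreflexive f -> irreflexive (strong_product e f).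
Proof. by move=> ie jf x; rewrite /strong_product ie jf !andbF. Qed.

(* Main.v *)
Require Import Defs.
From mathcomp Require Import all_boot.
From mathcomp Require Import zify.

(* Let V t be the set of the first t vertices of a legal sequence of length m.
   Each later vertex covers a new vertex, so |N(V t)| - t is nondecreasing in t
   and m <= n - (|N(V t)| - t) for every t.  It thus suffices to find a time t at
   which V t has a large excess |N(V t)| - |V t|.

   In a strong product, N(X) meets row i' in a superset of the closed
   neighbourhood of row i of X whenever i and i' are adjacent.  A nonempty row
   of X that is not too full therefore gains d = 1 (if it is a path) or d = 2
   (if it is a cycle) when it is matched with a neighbouring row.  On a cycle of
   rows, match row i with row i + 1; on a path of rows, swap the rows in pairs.
   If the path has an odd number of rows, the unmatched row may cost 1, but only
   for a rigid pattern of row sizes that determines t modulo k, so that time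
   t + 1 or t - 1 does better; this fails only for rows of length d + 2, where
   k d - 1 is enough except for P_3 x P_3, which is treated by hand.
   The first time at which some row or some column is (almost) full makes all
   columns, respectively all rows, nonempty and not too full. *)

Set Implicit Arguments.
Unset Strict Implicit.
Unset Printing Implicit Defensive.

(** * Excess of the neighbourhoods along a legal sequence *)

Section Neighbourhoods.

Variables (T : finType) (e : rel T).

Definition nbhs (X : {set T}) : {set T} := \bigcup_(v in X) open_nbh e v.

Lemma nbhsP (X : {set T}) (u : T) :
  reflect (exists2 v, v \in X & e v u) (u \in nbhs X).
Proof.
by apply: (iffP bigcupP) => -[v Xv]; rewrite ?inE => evu; exists v; rewrite ?inE.
Qed.

Lemma nbhsU (X Y : {set T}) : nbhs (X :|: Y) = nbhs X :|: nbhs Y.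
Proof. exact: bigcup_setU. Qed.

(* A legal sequence seen through the sets [V t] of its first t vertices. *)
Definition legal_chain (m : nat) (V : nat -> {set T}) : Prop :=
  V 0 = set0 /\ forall t, t < m -> exists v, V t.+1 = v |: V t /\
    exists2 u, e v u & u \notin nbhs (V t).

Lemma grundy_total_dom_chain : exists V, legal_chain (grundy_total_dom e) V.
Proof.
have [s /andP[_ /forallP legal_s]] := grundy_total_dom_attained e.
exists (fun t => [set x in take t s]); split=> [|t lt_tm].
  by rewrite take0; apply/setP=> x; rewrite !inE.
have /set0Pn[u] := legal_s (Ordinal lt_tm).
rewrite !inE => /andP[u_new u_t].
have x0 := tnth s (Ordinal lt_tm).
exists (tnth s (Ordinal lt_tm)); split.
  apply/setP=> x; rewrite (take_nth x0) ?size_tuple // !inE mem_rcons inE.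
  by rewrite (tnth_nth x0).
exists u => //; apply: contra u_new => /nbhsP[v].
rewrite inE => /(nthP x0)[j]; rewrite size_takel ?size_tuple ?(ltnW lt_tm) //.
move=> lt_jt; rewrite nth_take // => <- evu.
apply/bigcupP; exists (Ordinal (ltn_trans lt_jt lt_tm)) => //.
by rewrite inE (tnth_nth x0).
Qed.

Section Chain.

Variables (m : nat) (V : nat -> {set T}).
Hypothesis chainV : legal_chain m V.

(** A vertex already in [V t] has all its neighbours in [nbhs (V t)], so each step adds a genuinely
    new vertex. *)
Lemma card_chain t : t <= m -> #|V t| = t.
Proof.
elim: t => [_|t IHt lt_tm]; first by rewrite (proj1 chainV) cards0.
have [v [-> [u evu new_u]]] := (proj2 chainV) t lt_tm.
rewrite cardsU1 (IHt (ltnW lt_tm)); case: (boolP (v \in V t)) => // Vv.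
by case/nbhsP: new_u; exists v.
Qed.

Lemma leq_chain_excess s t :
  s <= t -> t <= m -> #|nbhs (V s)| + t <= #|nbhs (V t)| + s.
Proof.
move=> /subnK <-; elim: (t - s) => //= n IHn lt_m.
have [v [defV [u evu new_u]]] := (proj2 chainV) _ lt_m.
have: #|u |: nbhs (V (n + s))| <= #|nbhs (V (n + s).+1)|.
  apply: subset_leq_card; rewrite defV nbhsU subUset subsetUr andbT sub1set.
  by rewrite inE; apply/orP; left; apply/nbhsP; exists v; rewrite ?set11.
by rewrite cardsU1 new_u addSn; move: (IHn (ltnW lt_m)); lia.
Qed.

Lemma chain_length t : t <= m -> #|nbhs (V t)| + m <= #|T| + t.
Proof.
move=> le_tm; apply: leq_trans (leq_chain_excess le_tm (leqnn m)) _.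
by rewrite leq_add2r max_card.
Qed.

End Chain.
End Neighbourhoods.

(** * Expansion of vertex sets in cycles and paths *)

Section Expansion.

Variables (U : finType) (f : rel U).

(** The first field serves a row matched with an adjacent row, the second gives [d] in the partner
    of an empty row, and the third, which may lose 1, serves an unmatched row [A] beside a nonempty
    row [B]. *)
Record expands (d : nat) : Prop := Expands {
  leq_closed_nbhs : forall A : {set U}, A != set0 -> #|A| + d <= #|U| ->
    #|A| + d <= #|A :|: nbhs f A|;
  leq_nbhs : forall A : {set U}, A != set0 -> d <= #|nbhs f A|;
  leq_nbhs_closed_nbhs : forall A B : {set U}, B != set0 -> #|A| + d <= #|U| ->
    #|A| + d <= #|nbhs f A :|: (B :|: nbhs f B)|.+1 }.

End Expansion.

Lemma ordS_closed_setT (n : nat) (A : {set 'I_n}) (a : 'I_n) :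
  a \in A -> {in A, forall x, ordS x \in A} -> A = setT.
Proof.
move=> Aa AS; apply/setP=> x; rewrite inE.
have iterA j : iter j (@ordS n) a \in A by elim: j => //= j IHj; apply: AS.
have val_iter j : iter j (@ordS n) a = (a + j) %% n :> nat.
  elim: j => [|j IHj] /=; first by rewrite addn0 modn_small.
  by rewrite IHj -addn1 modnDml addn1 addnS.
(* [n - a] steps lead from [a] round to 0, and [x] more lead to [x]. *)
suff -> : x = iter (x + (n - a)) (@ordS n) a by rewrite iterA.
apply: val_inj; rewrite /= val_iter addnCA subnKC ?(ltnW (ltn_ord a)) //.
by rewrite modnDr modn_small.
Qed.

Lemma card_setU_ordS (n : nat) (A : {set 'I_n}) :
  A != set0 -> #|A| < n -> #|A| < #|A :|: (@ordS n) @: A|.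
Proof.
case/set0Pn=> a Aa ltAn; rewrite ltnNge; apply/negP => leA.
have AS : A :|: (@ordS n) @: A = A.
  by apply/esym/eqP; rewrite eqEcard subsetUl.
suff AT : A = setT by rewrite AT cardsT card_ord ltnn in ltAn.
apply: (ordS_closed_setT Aa) => x Ax; rewrite -AS inE.
by rewrite imset_f ?orbT.
Qed.

Lemma nbhs_cycle (n : nat) (A : {set 'I_n}) :
  nbhs (@cycle_graph n) A = (@ordS n) @: A :|: (@ord_pred n) @: A.
Proof.
apply/setP=> u; rewrite inE; apply/nbhsP/orP.
  case=> v Av /orP[/eqP<-|/eqP vE]; first by left; rewrite imset_f.
  by right; apply/imsetP; exists v; rewrite // -vE ordSK.
by case=> /imsetP[v Av ->]; exists v => //; rewrite /cycle_graph ?ord_predK eqxx ?orbT.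
Qed.

Lemma cycle_expands (n : nat) : 3 <= n -> expands (@cycle_graph n) 2.
Proof.
move=> n3; have injS : injective (@ordS n) := can_inj (@ordSK n).
have injP : injective (@ord_pred n) := can_inj (@ord_predK n).
have SP (A : {set 'I_n}) : (@ordS n) @: ((@ord_pred n) @: A) = A.
  by rewrite -imset_comp (eq_imset (g := id)) ?imset_id // => x; rewrite /= ord_predK.
split=> [A A0|A /set0Pn[a Aa]|A B /set0Pn[b Bb]]; rewrite ?card_ord.
- move=> leA.
  (* The closed neighbourhood arises from two one-sided extensions, [A] to [B] and [B] to [B] with
     its successors; each gains at least 1 until the cycle is full. *)
  pose B := (@ord_pred n) @: A :|: A.
  have -> : A :|: nbhs (@cycle_graph n) A = B :|: (@ordS n) @: B.
    rewrite nbhs_cycle /B imsetU SP; apply/setP=> x; rewrite !inE.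
    by do 3!case: (x \in _).
  have ltAB : #|A| < #|B|.
    have P0 : (@ord_pred n) @: A != set0.
      by case/set0Pn: A0 => a Aa; apply/set0Pn; exists (ord_pred a); rewrite imset_f.
    have := card_setU_ordS P0; rewrite SP card_imset //; apply; lia.
  have [ltBn|leBn] := ltnP #|B| n.
    have B0 : B != set0 by rewrite -card_gt0; lia.
    by rewrite addn2; apply: leq_ltn_trans ltAB (card_setU_ordS B0 ltBn).
  by apply: leq_trans (subset_leq_card (subsetUl _ _)); lia.
- have <- : #|[set ordS a; ord_pred a]| = 2.
    rewrite cards2; suff -> : ordS a != ord_pred a by [].
    apply/eqP => /(congr1 (@ordS n)); rewrite ord_predK => /(congr1 val) /=.
    have := ltn_ord a; case: a {Aa} => /= a _ lta.
    have [lt1|le1] := ltnP a.+1 n.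
      rewrite (modn_small lt1); have [lt2|le2] := ltnP a.+2 n.
        by rewrite modn_small //; lia.
      by have -> : a.+2 = n by [lia]; rewrite modnn; lia.
    by have -> : a.+1 = n by [lia]; rewrite modnn modn_small //; lia.
  apply: subset_leq_card; rewrite nbhs_cycle subUset !sub1set !inE.
  by rewrite !imset_f ?orbT.
- rewrite addn2 ltnS => ltAn; set I := _ :|: _.
  have SI : (@ordS n) @: A \subset I by rewrite /I nbhs_cycle -!setUA subsetUl.
  have PI : (@ord_pred n) @: A \subset I.
    by rewrite /I nbhs_cycle; apply/subsetP=> x Ax; rewrite !inE Ax orbT.
  have [Ib ISb] : b \in I /\ ordS b \in I.
    by rewrite /I nbhs_cycle nbhs_cycle !inE Bb (imset_f (@ordS n) Bb) ?orbT.
  (* Otherwise both shifts of [A] equal [I], so [I] is closed under the double shift; containing [b]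
     and its successor, it is the whole cycle, which is too large. *)
  clearbody I; rewrite ltnNge; apply/negP=> leI.
  have defI : (@ordS n) @: A = I by apply/eqP; rewrite eqEcard SI card_imset.
  have defI' : (@ord_pred n) @: A = I by apply/eqP; rewrite eqEcard PI card_imset.
  have I2 x : x \in I -> ordS (ordS x) \in I.
    rewrite -{1}defI' => /imsetP[y Ay ->]; rewrite ord_predK -defI.
    by rewrite imset_f.
  have IT : [set x in I | ordS x \in I] = setT.
    apply: (@ordS_closed_setT _ _ b); first by rewrite inE Ib.
    by move=> x; rewrite !inE => /andP[/I2-> ->].
  have: #|[set x in I | ordS x \in I]| <= #|I|.
    by apply: subset_leq_card; apply/subsetP=> x; rewrite inE => /andP[].
  by rewrite IT cardsT card_ord; lia.
Qed.

(** A set without new neighbours is closed under adjacency, and from [a] one walks up and down to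
    every vertex. *)
Lemma nbhs_path_proper (n : nat) (A : {set 'I_n}) :
  A != set0 -> #|A| < n -> #|A| < #|A :|: nbhs (@path_graph n) A|.
Proof.
case/set0Pn=> a Aa ltAn; rewrite ltnNge; apply/negP => leA.
have AN : A :|: nbhs (@path_graph n) A = A.
  by apply/esym/eqP; rewrite eqEcard subsetUl.
have stepA (x y : 'I_n) : x \in A -> path_graph x y -> y \in A.
  by move=> Ax xy; rewrite -AN inE; apply/orP; right; apply/nbhsP; exists x.
have up (j : nat) (x : 'I_n) : x = a + j :> nat -> x \in A.
  elim: j x => [|j IHj] x xE; first by rewrite (_ : x = a) //; apply: ord_inj; lia.
  have lt_x : a + j < n by have := ltn_ord x; lia.
  apply: (stepA (Ordinal lt_x)); first exact: IHj.
  by rewrite /path_graph /= xE; lia.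
have down (j : nat) (x : 'I_n) : x + j = a :> nat -> x \in A.
  elim: j x => [|j IHj] x xE; first by rewrite (_ : x = a) //; apply: ord_inj; lia.
  have lt_x : x.+1 < n by have := ltn_ord a; lia.
  apply: (stepA (Ordinal lt_x)); first by apply: IHj => /=; lia.
  by rewrite /path_graph /=; lia.
suff AT : A = setT by rewrite AT cardsT card_ord ltnn in ltAn.
apply/setP=> x; rewrite inE; have [le_ax|le_xa] := leqP a x.
  by apply: (up (x - a)); lia.
by apply: (down (a - x)); lia.
Qed.

(* The matching {0,1}, {2,3}, .. below the even number [u], and
   {u+1,u+2}, {u+3,u+4}, .. above it; [u] itself is fixed. *)
Definition match_around (u x : nat) : nat :=
  if x < u then (if odd x then x.-1 else x.+1)
  else if x == u then u else (if odd x then x.+1 else x.-1).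

(** The matching is an injection sending every vertex except [u] to a neighbour, so only [u] needs a
    separate reason to lie in [N]. For even [n], [u = n] is not a vertex and the matching is
    perfect. *)
Lemma leq_nbhs_match (n u : nat) (A N : {set 'I_n}) :
  ~~ odd u -> (odd n -> u < n) -> (~~ odd n -> u = n) ->
  nbhs (@path_graph n) A \subset N -> (forall x : 'I_n, x = u :> nat -> x \in N) ->
  #|A| <= #|N|.
Proof.
move=> ev_u odd_n even_n AN uN.
have lt_match (x : 'I_n) : match_around u x < n.
  rewrite /match_around; have := ltn_ord x; case: ifP; case: ifP; try case: ifP; lia.
have inj_match : injective (fun x : 'I_n => Ordinal (lt_match x)).
  move=> x y /(congr1 val) /=; rewrite /match_around => xy; apply: val_inj => /=.
  by move: xy; do 6?case: ifP; lia.
rewrite -(card_imset (mem A) inj_match); apply: subset_leq_card.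
apply/subsetP=> _ /imsetP[x Ax ->].
have [xu|xu] := eqVneq (x : nat) u.
  by apply: uN; rewrite /= /match_around xu ltnn eqxx.
apply: (subsetP AN); apply/nbhsP; exists x => //.
rewrite /path_graph /= /match_around; do 3?case: ifP; lia.
Qed.

Lemma path_expands (n : nat) : 2 <= n -> expands (@path_graph n) 1.
Proof.
move=> n2; split=> [A A0|A /set0Pn[a Aa]|A B /set0Pn[b Bb] _].
- by rewrite card_ord !addn1; apply: nbhs_path_proper.
- rewrite card_gt0; apply/set0Pn; have := ltn_ord a; rewrite leq_eqVlt => /orP[aE|lta].
    have lt_a : a.-1 < n by have := ltn_ord a; lia.
    by exists (Ordinal lt_a); apply/nbhsP; exists a; rewrite // /path_graph /=; lia.
  by exists (Ordinal lta); apply/nbhsP; exists a; rewrite // /path_graph /=; lia.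
- rewrite addn1 ltnS; case: (boolP (odd n)) => odd_n; last first.
    apply: (@leq_nbhs_match n n); rewrite ?subsetUl //; first by lia.
    by move=> x; have := ltn_ord x; lia.
  (* The fixed point must be even and lie in the closed neighbourhood of [b]. *)
  pose u := if odd b then b.-1 else (b : nat).
  apply: (@leq_nbhs_match n u); rewrite ?subsetUl //.
  + by rewrite /u; case: ifP; lia.
  + by move=> _; rewrite /u; have := ltn_ord b; case: ifP; lia.
  + by lia.
  move=> x; rewrite /u; case: ifP => [odd_b|_] xE; rewrite !inE; last first.
    by rewrite (_ : x = b) ?Bb ?orbT //; apply: val_inj.
  apply/orP; right; apply/orP; right; apply/nbhsP; exists b => //.
  by rewrite /path_graph xE; lia.
Qed.

(** * Summing the gains over a path of rows *)

Lemma path_sum_even (d q : nat) (x N : nat -> nat) :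
  (forall i, i.+1 < q.*2 -> x i + d <= N i.+1 /\ x i.+1 + d <= N i) ->
  \sum_(i < q.*2) x i + q.*2 * d <= \sum_(i < q.*2) N i.
Proof.
elim: q => [|q IHq] adj; first by rewrite !big_ord0.
have IH : \sum_(i < q.*2) x i + q.*2 * d <= \sum_(i < q.*2) N i.
  by apply: IHq => i lt_i; apply: adj; lia.
have [adj1 adj2] := adj q.*2 ltac:(lia).
have sumS (F : nat -> nat) : \sum_(i < q.+1.*2) F i
    = \sum_(i < q.*2) F i + F q.*2 + F q.*2.+1 :> nat.
  by rewrite doubleS !big_ord_recr.
by rewrite !sumS; lia.
Qed.

(* With an odd number of rows one row stays unmatched; the loss of 1 is real
   only if the sizes alternate between [x 0] and [x 0 - 1]. *)
Lemma path_sum_odd (d q : nat) (x N : nat -> nat) :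
  (forall i, i.+1 < q.*2.+1 -> x i + d <= N i.+1 /\ x i.+1 + d <= N i) ->
  (forall i, i < q.*2.+1 -> x i + d <= (N i).+1) ->
  \sum_(i < q.*2.+1) x i + q.*2.+1 * d <= \sum_(i < q.*2.+1) N i \/
  [/\ \sum_(i < q.*2.+1) x i + q.*2.+1 * d = (\sum_(i < q.*2.+1) N i).+1,
      \sum_(i < q.*2.+1) x i + q = q.*2.+1 * x 0
    & forall i, i < q.*2.+1 -> x i <= x 0 <= (x i).+1].
Proof.
move=> adj self.
(* The induction also tracks the last row: its size is [x 0] and its bound from [self] is
   attained. *)
suff: \sum_(i < q.*2.+1) x i + q.*2.+1 * d <= \sum_(i < q.*2.+1) N i \/
  [/\ \sum_(i < q.*2.+1) x i + q.*2.+1 * d = (\sum_(i < q.*2.+1) N i).+1,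
      \sum_(i < q.*2.+1) x i + q = q.*2.+1 * x 0, x q.*2 = x 0,
      (N q.*2).+1 = x q.*2 + d
    & forall i, i < q.*2.+1 -> x i <= x 0 <= (x i).+1].
  by case=> [|[]]; [left | right].
elim: q adj self => [|q IHq] adj self.
  rewrite double0 !big_ord1 /=; have := self 0 isT.
  have [|lt_N] := leqP (x 0 + d) (N 0); first by left; lia.
  by right; split; try lia; case; try lia.
have [adj1 adj2] := adj q.*2 ltac:(lia).
have [adj3 adj4] := adj q.*2.+1 ltac:(lia).
have self2 := self q.*2.+2 ltac:(lia).
have sumS (F : nat -> nat) : \sum_(i < q.+1.*2.+1) F i
    = \sum_(i < q.*2.+1) F i + F q.*2.+1 + F q.*2.+2 :> nat.
  by rewrite doubleS !big_ord_recr.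
rewrite !sumS doubleS.
have adj' i : i.+1 < q.*2.+1 -> x i + d <= N i.+1 /\ x i.+1 + d <= N i.
  by move=> lt_i; apply: adj; lia.
have self' i : i < q.*2.+1 -> x i + d <= (N i).+1.
  by move=> lt_i; apply: self; lia.
have [leN|[eqN sum_x xq Nq alt]] := IHq adj' self'; first by left; lia.
(* A gain beyond [2 d] in the two new rows repays the lost 1. Otherwise the inequalities close up
   and force the new sizes to be [x 0 - 1] and [x 0]. *)
have [tight|loose] := leqP (N q.*2.+1 + N q.*2.+2) (x q.*2.+1 + x q.*2.+2 + d * 2).
  right; split; try lia.
  move=> i; rewrite ltnS leq_eqVlt => /orP[/eqP->|]; first by lia.
  by rewrite ltnS leq_eqVlt => /orP[/eqP->|/alt]; lia.
by left; lia.
Qed.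

(** * Rows and columns of a strong product *)

Section Rows.

Variables (T U : finType) (e : rel T) (f : rel U).
Implicit Types (X : {set T * U}) (V : nat -> {set T * U}).

Definition row X (i : T) : {set U} := [set j | (i, j) \in X].

Lemma sum_card_row X : \sum_i #|row X i| = #|X|.
Proof.
rewrite -sum1_card; under eq_bigr do rewrite -sum1_card.
rewrite pair_big_dep /=; apply: eq_bigl => -[i j]; by rewrite inE.
Qed.

Lemma leq_card_rowU1 (v : T * U) X (i : T) :
  #|row X i| <= #|row (v |: X) i| <= #|row X i| + 1.
Proof.
have sub : row (v |: X) i \subset v.2 |: row X i.
  apply/subsetP=> j; rewrite !inE => /orP[/eqP<-|->]; rewrite ?orbT ?eqxx //.
apply/andP; split.
  by apply: subset_leq_card; apply/subsetP=> j; rewrite !inE => ->; rewrite orbT.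
apply: leq_trans (subset_leq_card sub) _; rewrite cardsU1 addnC leq_add2l.
exact: leq_b1.
Qed.

Lemma nbhs_row_sub X (i : T) :
  nbhs f (row X i) \subset row (nbhs (strong_product e f) X) i.
Proof.
apply/subsetP=> u /nbhsP[v]; rewrite !inE => Xv fvu; apply/nbhsP; exists (i, v) => //.
by rewrite /strong_product /= eqxx fvu orbT.
Qed.

Lemma closed_nbhs_row_sub X (i i' : T) : e i i' ->
  row X i :|: nbhs f (row X i) \subset row (nbhs (strong_product e f) X) i'.
Proof.
move=> ei; rewrite subUset; apply/andP; split; apply/subsetP=> u.
  rewrite !inE => Xu; apply/nbhsP; exists (i, u) => //.
  by rewrite /strong_product /= ei eqxx.
case/nbhsP=> v; rewrite !inE => Xv fvu; apply/nbhsP; exists (i, v) => //.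
by rewrite /strong_product /= ei fvu !orbT.
Qed.

Section Gain.

Variable d : nat.
Hypothesis fd : expands f d.

Lemma row_gain X (i i' : T) : e i i' -> row X i != set0 ->
  #|row X i| + d <= #|U| ->
  #|row X i| + d <= #|row (nbhs (strong_product e f) X) i'|.
Proof.
move=> ei X0 ltX; apply: leq_trans (leq_closed_nbhs fd X0 ltX) _.
exact: subset_leq_card (closed_nbhs_row_sub X ei).
Qed.

Lemma row_gain_self X (i i' : T) : e i i' -> row X i != set0 ->
  #|row X i'| + d <= #|U| ->
  #|row X i'| + d <= #|row (nbhs (strong_product e f) X) i'|.+1.
Proof.
move=> ei X0 ltX; apply: leq_trans (leq_nbhs_closed_nbhs fd X0 ltX) _.
by rewrite ltnS subset_leq_card // subUset nbhs_row_sub closed_nbhs_row_sub.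
Qed.

Lemma row_gain0 X (i i' : T) : (i == i') || e i i' -> row X i != set0 ->
  d <= #|row (nbhs (strong_product e f) X) i'|.
Proof.
move=> /predU1P ei X0; apply: leq_trans (leq_nbhs fd X0) (subset_leq_card _).
case: ei => [<-|ei]; first exact: nbhs_row_sub.
by apply: subset_trans (closed_nbhs_row_sub X ei); apply: subsetUr.
Qed.

End Gain.

(** Columns are handled as rows of the transposed set. *)
Definition swap_set X : {set U * T} := [set p | (p.2, p.1) \in X].

Lemma swap_chain m V : legal_chain (strong_product e f) m V ->
  legal_chain (strong_product f e) m (fun t => swap_set (V t)).
Proof.
case=> V0 legalV; split; first by rewrite V0; apply/setP=> x; rewrite !inE.
have swap_adj (x y : T * U) :
    strong_product f e (x.2, x.1) (y.2, y.1) = strong_product e f x y.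
  by rewrite /strong_product /= [LHS]orbCA andbC [f _ _ && (_ == _)]andbC
             [f _ _ && _]andbC.
move=> t /legalV[v [-> [u vu new_u]]]; exists (v.2, v.1); split.
  by apply/setP=> -[i j]; case: (v) => a b; rewrite !inE !xpair_eqE andbC.
exists (u.2, u.1); first by rewrite swap_adj.
apply: contra new_u => /nbhsP[w]; rewrite inE => Vw wu; apply/nbhsP.
by exists (w.2, w.1) => //; rewrite -swap_adj /=; case: w wu {Vw}.
Qed.

End Rows.

(** * Length bounds from the rows at a single time *)

Lemma cycle_rows_bound (k d t m : nat) (U : finType) (f : rel U)
    (V : nat -> {set 'I_k * U}) :
  expands f d -> legal_chain (strong_product (@cycle_graph k) f) m V ->
  t <= m -> (forall i, #|row (V t) i| + d <= #|U|) ->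
  (forall i, [|| row (V t) i != set0, row (V t) (ordS i) != set0
               | row (V t) (ordS (ordS i)) != set0]) ->
  m + k * d <= k * #|U|.
Proof.
move=> fd chainV le_tm smallV thickV.
have gain : #|V t| + k * d <= #|nbhs (strong_product (@cycle_graph k) f) (V t)|.
  (* Shifting the right-hand sum matches row [i] with row [i + 1]. *)
  rewrite -!sum_card_row [leqRHS](reindex_inj (can_inj (@ordSK k))) /=.
  rewrite -[k in k * d]card_ord -sum_nat_const -big_split /=.
  apply: leq_sum => i _.
  (* If row [i] is empty, only [d] covered vertices are needed in row [i + 1]; row [i + 1] itself or
     row [i + 2] supplies them. *)
  have [Vi0|Vi] := eqVneq (row (V t) i) set0; last first.
    by apply: row_gain => //; rewrite /cycle_graph eqxx.
  have := thickV i; rewrite Vi0 eqxx cards0 add0n /= => /orP[] Vi.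
    by apply: row_gain0 Vi => //; rewrite eqxx.
  by apply: row_gain0 Vi => //; rewrite /cycle_graph eqxx !orbT.
have := chain_length chainV le_tm.
by rewrite card_prod card_ord; rewrite (card_chain chainV le_tm) in gain; lia.
Qed.

Definition thick_rows (T U : finType) (d : nat) (X : {set T * U}) : Prop :=
  forall i, row X i != set0 /\ #|row X i| + d <= #|U|.

Section PathRows.

Variables (k d m : nat) (U : finType) (f : rel U) (V : nat -> {set 'I_k * U}).
Hypothesis k2 : 1 < k.
Hypothesis fd : expands f d.
Hypothesis chainV : legal_chain (strong_product (@path_graph k) f) m V.

(** The second alternative is the rigid pattern of [path_sum_odd]; as the row sizes add up to [t],
    it makes [t + k./2] a multiple of [k]. *)
Lemma path_rows_gain t : t <= m -> thick_rows d (V t) ->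
  m + k * d <= k * #|U| \/
  [/\ odd k, m + k * d <= (k * #|U|).+1 &
    exists i0 : 'I_k, t + k./2 = k * #|row (V t) i0| /\
      forall i, #|row (V t) i| <= #|row (V t) i0| <= #|row (V t) i|.+1].
Proof.
move=> le_tm thickV; have := chain_length chainV le_tm.
have := card_chain chainV le_tm.
rewrite card_prod card_ord -!sum_card_row.
case: k k2 V chainV thickV => // n n1 W _ thickW.
set NW := nbhs _ _.
pose x i := #|row (W t) (inord i)|; pose N i := #|row NW (inord i)|.
have sumx : \sum_i #|row (W t) i| = \sum_(i < n.+1) x i.
  by apply: eq_bigr => i _; rewrite /x inord_val.
have sumN : \sum_i #|row NW i| = \sum_(i < n.+1) N i.
  by apply: eq_bigr => i _; rewrite /N inord_val.
rewrite sumx sumN => sum_t leN.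
have adj i : i.+1 < n.+1 -> x i + d <= N i.+1 /\ x i.+1 + d <= N i.
  move=> lt_i; have [W1 W2] := (thickW (inord i), thickW (inord i.+1)).
  by split; apply: row_gain => //; rewrite /path_graph ?inordK ?eqxx ?orbT //; lia.
have self i : i < n.+1 -> x i + d <= (N i).+1.
  move=> lt_i; have [_ Wi] := thickW (inord i).
  have [j ji] : exists j : 'I_n.+1, path_graph j (inord i).
    case: i lt_i {Wi} => [|i] lt_i.
      by exists (inord 1); rewrite /path_graph !inordK ?orbT.
    by exists (inord i); rewrite /path_graph !inordK ?eqxx //; lia.
  by have [Wj _] := thickW j; apply: row_gain_self fd _ _ _ ji Wj Wi.
have xE i : #|row (W t) i| = x i by rewrite /x inord_val.
have n_half := odd_double_half n.+1.
case: (boolP (odd n.+1)) => odd_n.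
  have halfK : n.+1./2.*2.+1 = n.+1 by rewrite -[RHS]n_half odd_n.
  have := @path_sum_odd d n.+1./2 x N; rewrite halfK.
  move=> /(_ adj self)[|[tight sum_q alt]]; first by left; lia.
  right; split=> //; first by lia.
  exists ord0; rewrite xE; split; first by rewrite -sum_t.
  by move=> i; rewrite xE; apply: alt.
have halfK : n.+1./2.*2 = n.+1 by rewrite -[RHS]n_half (negPf odd_n).
have := @path_sum_even d n.+1./2 x N; rewrite halfK => /(_ adj); left.
by lia.
Qed.

Lemma path_rows_bound t : t <= m -> thick_rows d (V t) ->
  m + k * d <= k * #|U| \/ [/\ odd k, #|U| = d.+2 & m + k * d <= (k * #|U|).+1].
Proof.
move=> le_tm thickV.
have [|[odd_k le_m [i0 [t_q alt]]]] := path_rows_gain le_tm thickV; first by left.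
have half_k : 0 < k./2 by have := odd_double_half k; rewrite odd_k; lia.
set c := #|row (V t) i0| in t_q alt.
(* Tightness at both times would give two multiples of [k], [s + k./2] and [t + k./2], that differ
   by 1. *)
have untight s : s <= m -> s = t.+1 \/ s.+1 = t -> thick_rows d (V s) ->
    m + k * d <= k * #|U|.
  move=> le_sm st /(path_rows_gain le_sm)[] // [_ _ [i1 [s_q _]]].
  set c' := #|_| in s_q.
  have [cc'|cc'|cc'] := ltngtP c c'.
  - have : k * c.+1 <= k * c' by rewrite leq_mul2l cc' orbT.
    by rewrite mulnS; move: k2 t_q s_q st; clear; lia.
  - have : k * c'.+1 <= k * c by rewrite leq_mul2l cc' orbT.
    by rewrite mulnS; move: k2 t_q s_q st; clear; lia.
  - by rewrite -cc' in s_q; lia.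
have leUc : c + d <= #|U| by case: (thickV i0).
(* Since [c] is the largest row size, there is room to step forward to [t.+1], unless the sequence
   ends at [t], where the equation for [t] gives the bound directly. *)
have [lt_c|ge_c] := ltnP (c + d) #|U|.
  left; move: le_tm; rewrite leq_eqVlt => /orP[/eqP tm|lt_tm].
    have : k * (c + d) <= k * #|U| by rewrite leq_mul2l leUc orbT.
    by rewrite mulnDr; lia.
  apply: (untight t.+1) => //; first by left.
  have [v [-> _]] := (proj2 chainV) _ lt_tm.
  move=> i; have /andP[le1 le2] := leq_card_rowU1 v (V t) i.
  have [Vi0 Vi] := thickV i; have /andP[alt1 alt2] := alt i.
  rewrite -card_gt0 in Vi0; rewrite -card_gt0; split; first exact: leq_trans Vi0 le1.
  apply: leq_trans (leq_add le2 (leqnn d)) _; lia.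
(* All rows are nonempty, so [t >= k], and [k * c = t + k./2] exceeds [k]. *)
have c_gt1 : 1 < c.
  have: k <= t.
    rewrite -(card_chain chainV le_tm) -sum_card_row -[leqLHS]card_ord -sum1_card.
    by apply: leq_sum => i _; rewrite card_gt0; case: (thickV i).
  by have := leq_mul2l k c 1; case: ltnP => // _; rewrite orbT muln1; lia.
(* Now [c + d = #|U|], so [c = 2] is the exceptional alternative. For [c >= 3] every row has at
   least 2 vertices, and stepping back one time leaves all rows nonempty. *)
have [c2|c2] := eqVneq c 2; first by right; split=> //; lia.
left; clearbody c; case: t => [|t] in le_tm thickV t_q alt untight *.
  by have [+ _] := thickV i0; rewrite (proj1 chainV) => /set0Pn[x]; rewrite !inE.
apply: (untight t); [exact: ltnW | by right | move=> i].
have [Vi0 Vi] := thickV i; have /andP[alt1 alt2] := alt i.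
have [v [defV _]] := (proj2 chainV) _ le_tm.
have := leq_card_rowU1 v (V t) i; rewrite -defV => /andP[le1 le2].
rewrite -card_gt0; split; last by apply: leq_trans Vi; rewrite leq_add2r.
by rewrite -(leq_add2r 1); apply: leq_trans le2; lia.
Qed.

End PathRows.

(** * The first critical time, and the products with a cycle factor *)

Lemma first_time (p : pred nat) (m : nat) :
  (forall t, t <= m -> ~~ p t) \/
  exists2 t, t <= m & p t /\ forall s, s < t -> ~~ p s.
Proof.
case: (boolP (has p (iota 0 m.+1))) => [/hasP[t0 t0_m pt0]|/hasPn no_p].
  right; have [t pt min_t] := ex_minnP (ex_intro p t0 pt0).
  exists t; first by have := min_t _ pt0; rewrite mem_iota in t0_m; lia.
  by split=> // s; apply: contraTN => ps; rewrite -leqNgt min_t.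
by left=> t le_tm; apply: no_p; rewrite mem_iota; lia.
Qed.

Lemma swap_setK (T U : finType) (X : {set T * U}) : swap_set (swap_set X) = X.
Proof. by apply/setP=> -[i j]; rewrite !inE. Qed.

Lemma mem_row (T U : finType) (X : {set T * U}) (i : T) (j : U) :
  (j \in row X i) = ((i, j) \in X).
Proof. by rewrite inE. Qed.

Lemma mem_row_swap (T U : finType) (X : {set T * U}) (i : T) (j : U) :
  (i \in row (swap_set X) j) = (j \in row X i).
Proof. by rewrite !inE. Qed.

Lemma leq_card_row_chain (T U : finType) (e : rel (T * U)) (m t : nat)
    (V : nat -> {set T * U}) (i : T) :
  legal_chain e m V -> t < m -> #|row (V t.+1) i| <= #|row (V t) i| + 1.
Proof.
move=> [_ chainV] /chainV[v [-> _]].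
by case/andP: (leq_card_rowU1 v (V t) i).
Qed.

Lemma row_chain0 (T U : finType) (e : rel (T * U)) (m : nat)
    (V : nat -> {set T * U}) (i : T) : legal_chain e m V -> #|row (V 0) i| = 0.
Proof.
by case=> -> _; apply/eqP; rewrite cards_eq0; apply/eqP/setP=> j; rewrite !inE.
Qed.

Lemma leq_sum_rows (T U : finType) (X : {set T * U}) (d : nat) :
  (forall i, #|row X i| + d <= #|U|) -> #|X| + #|T| * d <= #|T| * #|U|.
Proof.
move=> ltX; rewrite -sum_card_row -!sum_nat_const -big_split /=.
by apply: leq_sum => i _; apply: ltX.
Qed.

Lemma cycle_window (n : nat) (A : {set 'I_n}) (j : 'I_n) : 3 <= n ->
  n <= #|A| + 2 -> [|| j \in A, ordS j \in A | ordS (ordS j) \in A].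
Proof.
move=> n3 leA; apply: contraTT leA; rewrite !negb_or => /and3P[j0 j1 j2].
rewrite -ltnNge; set J := [set j; ordS j; ordS (ordS j)].
have J3 : #|J| = 3.
  have neqS x : x != ordS x :> 'I_n.
    by have := cycle_graph_irr n3 x; rewrite /cycle_graph orbb eq_sym => ->.
  (* [ordS j] has at least two neighbours, and they are among [j] and [ordS (ordS j)]. *)
  have neqSS : j != ordS (ordS j).
    have Sj0 : [set ordS j] != set0 by apply/set0Pn; exists (ordS j); rewrite set11.
    have := leq_nbhs (cycle_expands n3) Sj0.
    rewrite nbhs_cycle !imset_set1 ordSK cards2 eq_sym.
    by case: eqVneq.
  rewrite /J -setUA cardsU1 cards2 !inE negb_or neqS neqSS.
  by rewrite (neqS (ordS j)).
have: J \subset ~: A by apply/subsetP=> x; rewrite !inE => /orP[/orP[]|] /eqP->.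
move=> /subset_leq_card; rewrite J3.
by rewrite -(leq_add2l #|A|) (cardsC A) card_ord addnS.
Qed.

(** A nearly full row thus provides the occupancy hypothesis of [cycle_rows_bound] for the
    columns. *)
Lemma crossed_columns (k l : nat) (X : {set 'I_k * 'I_l}) (i : 'I_k) (j : 'I_l) :
  3 <= l -> l <= #|row X i| + 2 ->
  [|| row (swap_set X) j != set0, row (swap_set X) (ordS j) != set0
    | row (swap_set X) (ordS (ordS j)) != set0].
Proof.
move=> l3 /(cycle_window j l3) cross.
have nz j' : j' \in row X i -> row (swap_set X) j' != set0.
  by move=> Xj; apply/set0Pn; exists i; rewrite mem_row_swap.
by case/or3P: cross => /nz ->; rewrite ?orbT.
Qed.

(** The critical time is the first at which a row or column misses at most 2 vertices. One step
    earlier all missed at least 3, so now all miss at least 2, and the nearly full one crosses the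
    others. Without such a time, counting rows suffices. *)
Lemma cycle_cycle_bound (k l m : nat) (V : nat -> {set 'I_k * 'I_l}) :
  3 <= k -> 3 <= l ->
  legal_chain (strong_product (@cycle_graph k) (@cycle_graph l)) m V ->
  m + minn (2 * k) (2 * l) <= k * l.
Proof.
move=> k3 l3 chainV; have chainW := swap_chain chainV.
have := first_time (fun t => [exists i, l <= #|row (V t) i| + 2]
  || [exists j, k <= #|row (swap_set (V t)) j| + 2]) m.
case=> [no_t|[t le_tm [+ before_t]]].
  have: #|V m| + #|'I_k| * 2 <= #|'I_k| * #|'I_l|.
    apply: leq_sum_rows => i; rewrite card_ord.
    by have := no_t m (leqnn m); rewrite negb_or => /andP[/existsPn/(_ i)]; lia.
  by rewrite (card_chain chainV) // !card_ord; lia.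
case: t le_tm before_t => [|t] lt_tm before_t.
  case/orP=> /existsP[i]; rewrite ?(row_chain0 i chainV) ?(row_chain0 i chainW); lia.
have := before_t t (ltnSn t); rewrite negb_or => /andP[/existsPn rowV /existsPn colV].
case/orP=> /existsP[i0 full].
  have := cycle_rows_bound (cycle_expands k3) chainW lt_tm.
  rewrite card_ord => bound; suff: m + l * 2 <= l * k by lia.
  apply: bound => j; last exact: crossed_columns full.
  by have := leq_card_row_chain j chainW lt_tm; have := colV j; lia.
have := cycle_rows_bound (cycle_expands l3) chainV lt_tm.
rewrite card_ord => bound; suff: m + k * 2 <= k * l by lia.
apply: bound => i.
  by have := leq_card_row_chain i chainV lt_tm; have := rowV i; lia.
by rewrite -[V t.+1]swap_setK; apply: crossed_columns full.
Qed.

Lemma path_cycle_bound (k l m : nat) (V : nat -> {set 'I_k * 'I_l}) :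
  3 <= k -> 3 <= l ->
  legal_chain (strong_product (@path_graph k) (@cycle_graph l)) m V ->
  m + minn (2 * k) l <= k * l.
Proof.
move=> k3 l3 chainV; have chainW := swap_chain chainV.
have := first_time (fun t => [exists i, l <= #|row (V t) i| + 2]
  || [exists j, k <= #|row (swap_set (V t)) j|]) m.
case=> [no_t|[t le_tm [+ before_t]]].
  have: #|V m| + #|'I_k| * 2 <= #|'I_k| * #|'I_l|.
    apply: leq_sum_rows => i; rewrite card_ord.
    by have := no_t m (leqnn m); rewrite negb_or => /andP[/existsPn/(_ i)]; lia.
  by rewrite (card_chain chainV) // !card_ord; lia.
case: t le_tm before_t => [|t] lt_tm before_t.
  case/orP=> /existsP[i]; rewrite ?(row_chain0 i chainV) ?(row_chain0 i chainW); lia.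
have := before_t t (ltnSn t); rewrite negb_or => /andP[/existsPn rowV /existsPn colV].
(* The column case comes first because the row case needs that no column is full at time [t.+1]
   itself. *)
have [/existsP[j0 full] _|] := boolP [exists j, k <= #|row (swap_set (V t.+1)) j|].
  have colT : row (swap_set (V t.+1)) j0 = setT.
    by apply/eqP; rewrite eqEcard subsetT cardsT card_ord.
  have thickV : thick_rows 2 (V t.+1).
    move=> i; split; last first.
      by rewrite card_ord; have := leq_card_row_chain i chainV lt_tm; have := rowV i; lia.
    by apply/set0Pn; exists j0; rewrite -mem_row_swap colT inE.
  have := path_rows_bound (ltnW k3) (cycle_expands l3) chainV lt_tm thickV.
  (* In the exceptional case [l = 4], and [2 * k - 1 >= 4] is enough. *)
  by rewrite card_ord => -[|[]]; lia.
move=> /existsPn colV'; rewrite orbF => /existsP[i0 full].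
have := cycle_rows_bound (path_expands (ltnW k3)) chainW lt_tm.
rewrite card_ord => bound; suff: m + l * 1 <= l * k by lia.
apply: bound => j; last exact: crossed_columns full.
by have := colV' j; lia.
Qed.

(** Time [t] serves if all rows are already nonempty. Otherwise the vertex added last is where an
    empty row [i] crosses column [j], so at [t.+1] row [i] has one vertex and the other rows are
    unchanged. *)
Lemma path_path_full_column (k l m t : nat) (V : nat -> {set 'I_k * 'I_l})
    (j : 'I_l) :
  3 <= k -> 3 <= l -> (k, l) != (3, 3) ->
  legal_chain (strong_product (@path_graph k) (@path_graph l)) m V ->
  t < m -> (forall i, #|row (V t) i| < l) -> row (swap_set (V t.+1)) j = setT ->
  m + minn k l <= k * l.
Proof.
move=> k3 l3 kl3 chainV lt_tm ltV fullV.
suff [s le_sm thickV] : exists2 s, s <= m & thick_rows 1 (V s).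
  have := path_rows_bound (ltnW k3) (path_expands (ltnW l3)) chainV le_sm thickV.
  rewrite card_ord => -[|[odd_k l3' le_m]]; first by lia.
  (* Here [l = 3] and [k] is odd, so [k >= 5] and the weaker gain [k - 1] is still at least 3. *)
  have: k != 3 by apply: contraNneq kl3 => ->; rewrite l3'.
  by have := odd_double_half k; rewrite odd_k; lia.
case: (boolP [forall i, row (V t) i != set0]) => [/forallP nzV|].
  by exists t => [|i]; [exact: ltnW | rewrite card_ord addn1].
rewrite negb_forall => /existsP[i]; rewrite negbK => /eqP Vi0.
exists t.+1 => // i'; rewrite card_ord addn1; split.
  by apply/set0Pn; exists j; rewrite -mem_row_swap fullV inE.
have [v [defV _]] := (proj2 chainV) _ lt_tm.
have [<-|ii'] := eqVneq i i'.
  have := leq_card_row_chain i chainV lt_tm; rewrite Vi0 cards0.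
  by move=> le1; apply: leq_ltn_trans le1 _; lia.
have vE : v = (i, j).
  have: j \in row (V t.+1) i by rewrite -mem_row_swap fullV inE.
  by rewrite defV mem_row in_setU1 -mem_row Vi0 inE orbF => /eqP.
suff -> : row (V t.+1) i' = row (V t) i' by [].
by apply/setP=> j'; rewrite defV !inE vE xpair_eqE eq_sym (negPf ii').
Qed.

(** * The product of two paths on three vertices, by explicit counting *)

Lemma count_leq_card (T : finType) (a : pred T) (s : seq T) :
  uniq s -> count a s <= #|[set x | a x]|.
Proof.
move=> uniq_s; rewrite -size_filter -(card_uniqP (filter_uniq a uniq_s)).
by apply: subset_leq_card; apply/subsetP=> x; rewrite mem_filter inE => /andP[].
Qed.

Section King3.

Let o0 : 'I_3 := Ordinal (isT : 0 < 3).
Let o1 : 'I_3 := Ordinal (isT : 1 < 3).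
Let o2 : 'I_3 := Ordinal (isT : 2 < 3).
Let cells : seq ('I_3 * 'I_3) :=
  [:: (o0, o0); (o0, o1); (o0, o2); (o1, o0); (o1, o1); (o1, o2);
      (o2, o0); (o2, o1); (o2, o2)].
Let king3 := strong_product (@path_graph 3) (@path_graph 3).
Let corner (x : 'I_3 * 'I_3) := (x.1 != o1) && (x.2 != o1).

(* The first vertex that is not a corner covers two corners, and corners are
   not covered by corners. *)
Lemma king3_bound (m : nat) (V : nat -> {set 'I_3 * 'I_3}) :
  legal_chain king3 m V -> m <= 6.
Proof.
move=> chainV.
have deg3 v : 3 <= #|open_nbh king3 v|.
  apply: leq_trans (count_leq_card (s := cells) _ _) => //.
  by case: v => [[[|[|[|?]]] ?] [[|[|[|?]]] ?]].
have deg4 v : ~~ corner v -> 4 <= #|open_nbh king3 v|.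
  move=> cv; apply: leq_trans (count_leq_card (s := cells) _ _) => //.
  by case: v cv => [[[|[|[|?]]] ?] [[|[|[|?]]] ?]].
have corner2 v : ~~ corner v -> 2 <= #|[set x | king3 v x && corner x]|.
  move=> cv; apply: leq_trans (count_leq_card (s := cells) _ _) => //.
  by case: v cv => [[[|[|[|?]]] ?] [[|[|[|?]]] ?]].
have corner_adj v w : corner v -> corner w -> ~~ king3 v w.
  by case: v w => [[[|[|[|?]]] ?] [[|[|[|?]]] ?]] [[[|[|[|?]]] ?] [[|[|[|?]]] ?]].
have card9 : #|{: 'I_3 * 'I_3}| = 9 by rewrite card_prod card_ord.
have := first_time (fun t => [exists x in V t, ~~ corner x]) m.
case=> [no_t|[[|t] lt_tm [/exists_inP[v Vv cv] before_t]]].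
- have: V m \subset [:: (o0, o0); (o0, o2); (o2, o0); (o2, o2)].
    apply/subsetP=> x Vx; have: corner x.
      by apply: contraNT (no_t m (leqnn m)) => cx; apply/exists_inP; exists x.
    by case: x {Vx} => [[[|[|[|?]]] ?] [[|[|[|?]]] ?]].
  move=> /subset_leq_card; rewrite (card_chain chainV) // => le_m.
  by have := leq_trans le_m (card_size _); rewrite /=; lia.
- by move: Vv; rewrite (proj1 chainV) inE.
have cornerV w : w \in V t -> corner w.
  by move=> Vw; apply: contraNT (before_t t (ltnSn t)) => cw; apply/exists_inP; exists w.
(* An excess of 3 among 9 vertices leaves length at most 6. *)
suff: t.+1 + 3 <= #|nbhs king3 (V t.+1)|.
  by have := chain_length chainV lt_tm; rewrite card9; lia.
have [w [defV _]] := (proj2 chainV) _ lt_tm.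
have wv : w = v.
  move: Vv; rewrite defV in_setU1 => /predU1P[-> //|/cornerV].
  by rewrite (negPf cv).
have nbhs1 x : nbhs king3 [set x] = open_nbh king3 x by exact: big_set1.
case: t => [|t] in lt_tm before_t cornerV defV {Vv} *.
  by rewrite defV (proj1 chainV) setU0 nbhs1 wv; apply: deg4.
(* The first vertex has degree at least 3, so the excess is at least 2 from then on. *)
have le_N : t.+3 <= #|nbhs king3 (V t.+1)|.
  have lt_0m : 0 < m by lia.
  have [x [defV1 _]] := (proj2 chainV) _ lt_0m.
  have := leq_chain_excess chainV (isT : 1 <= t.+1) (ltnW lt_tm).
  by rewrite defV1 (proj1 chainV) setU0 nbhs1; have := deg3 x; lia.
(* [V t.+1] consists of corners and covers no corner, so the two corners covered by [v] raise the
   excess to 3. *)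
apply: (@leq_trans #|nbhs king3 (V t.+1) :|: [set x | king3 v x && corner x]|).
  rewrite cardsU disjoint_setI0 ?cards0 ?subn0; first by have := corner2 v cv; lia.
  rewrite disjoint_subset; apply/subsetP=> x /nbhsP[y /cornerV cy yx].
  rewrite !inE negb_and; case: (boolP (corner x)) => [cx|]; rewrite ?orbT //.
  by rewrite (negPf (corner_adj _ _ cy cx)) in yx.
apply: subset_leq_card; rewrite defV nbhsU nbhs1 wv setUC setSU //.
by apply/subsetP=> x; rewrite !inE => /andP[].
Qed.

End King3.

(** * The product of two paths, and the three bounds together *)

Lemma path_path_bound (k l m : nat) (V : nat -> {set 'I_k * 'I_l}) :
  3 <= k -> 3 <= l ->
  legal_chain (strong_product (@path_graph k) (@path_graph l)) m V ->
  m + minn k l <= k * l.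
Proof.
move=> k3 l3 chainV; have chainW := swap_chain chainV.
have [[kE lE]|kl3] := eqVneq (k, l) (3, 3).
  by subst k l; have := king3_bound chainV; lia.
have := first_time (fun t => [exists i, l <= #|row (V t) i|]
  || [exists j, k <= #|row (swap_set (V t)) j|]) m.
case=> [no_t|[t le_tm [+ before_t]]].
  have: #|V m| + #|'I_k| * 1 <= #|'I_k| * #|'I_l|.
    apply: leq_sum_rows => i; rewrite card_ord.
    by have := no_t m (leqnn m); rewrite negb_or => /andP[/existsPn/(_ i)]; lia.
  by rewrite (card_chain chainV) // !card_ord; lia.
case: t le_tm before_t => [|t] lt_tm before_t.
  case/orP=> /existsP[i]; rewrite ?(row_chain0 i chainV) ?(row_chain0 i chainW); lia.
have := before_t t (ltnSn t); rewrite negb_or => /andP[/existsPn rowV /existsPn colV].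
case/orP=> /existsP[i0 full].
  have lk3 : (l, k) != (3, 3) by rewrite xpair_eqE andbC -xpair_eqE.
  suff: m + minn l k <= l * k by lia.
  apply: (path_path_full_column l3 k3 lk3 chainW lt_tm (j := i0)).
    by move=> j; have := colV j; lia.
  by rewrite swap_setK; apply/eqP; rewrite eqEcard subsetT cardsT card_ord.
apply: (path_path_full_column k3 l3 kl3 chainV lt_tm (j := i0)).
  by move=> i; have := rowV i; lia.
by apply/eqP; rewrite eqEcard subsetT cardsT card_ord.
Qed.

Theorem theorem4p6 (k l : nat) (hk : 3 <= k) (hl : 3 <= l) :
  [/\ grundy_total_dom (strong_product (@path_graph k) (@path_graph l))
        <= k * l - minn k l,
      grundy_total_dom (strong_product (@cycle_graph k) (@cycle_graph l))
        <= k * l - minn (2 * k) (2 * l)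
    & grundy_total_dom (strong_product (@path_graph k) (@cycle_graph l))
        <= k * l - minn (2 * k) l].
Proof.
split.
- have [V /(path_path_bound hk hl)] :=
    grundy_total_dom_chain (strong_product (@path_graph k) (@path_graph l)).
  by lia.
- have [V /(cycle_cycle_bound hk hl)] :=
    grundy_total_dom_chain (strong_product (@cycle_graph k) (@cycle_graph l)).
  by lia.
- have [V /(path_cycle_bound hk hl)] :=
    grundy_total_dom_chain (strong_product (@path_graph k) (@cycle_graph l)).
  by lia.
Qed.
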